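(* Let $(X,\mu_1,\mu_2)$ be a generalized bitopological space that is pairwise $R_0$ and pairwise $\lambda$-symmetric. Then the following are equivalent: (1) $(X,\mu_1,\mu_2)$ is pairwise $T_0$; (2) $(X,\mu_1,\mu_2)$ is pairwise $T_1$; (3) $(X,\mu_1,\mu_2)$ is pairwise $T_{\frac12}$; (4) $(X,\mu_1,\mu_2)$ is pairwise $T_{\frac58}$; (5) $(X,\mu_1,\mu_2)$ is pairwise $T_{\frac38}$; (6) $(X,\mu_1,\mu_2)$ is pairwise $T_{\frac14}$.
   Context: Countable means finite or countably infinite. A generalized topology on a nonempty set $X$ is a collection $\mu$ of subsets of $X$ that contains $\emptyset$ and is closed under arbitrary unions ($X$ itself need not belong to $\mu$). Members of $\mu$ are called $\mu$-open and their complements $\mu$-closed. The $\mu$-closure $\overline{A_{\mu}}$ of $A$ is the intersection of all $\mu$-closed sets containing $A$. A generalized bitopological space (GBT-space) $(X,\mu_1,\mu_2)$ is a nonempty set $X$ with two generalized topologies $\mu_1,\mu_2$. Pairwise $R_0$: for all $i,j\in\{1,2\}$ with $i\neq j$ and each $\mu_i$-open set $G$, $x\in G$ implies $\overline{\{x\}_{\mu_j}}\subset G$. Pairwise $T_0$: for any two distinct points of $X$, the two points can be named $x,y$ (in one of the two possible orders) so that either there is a $\mu_1$-open set $U$ with $x\in U$, $y\notin U$, or there is a $\mu_2$-open set $V$ with $y\in V$, $x\notin V$. Pairwise $T_1$: for any two distinct points of $X$, the two points can be named $x,y$ (in one of the two possible orders) so that there exist $U\in\mu_1$ and $V\in\mu_2$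 with $x\in U$, $y\notin U$, $y\in V$, $x\notin V$. For $i\neq j$ in $\{1,2\}$, $A\subset X$ is $g_{\mu_i}$-closed with respect to $\mu_j$ if $\overline{A_{\mu_i}}\subset U$ for every $\mu_j$-open set $U\supset A$. Pairwise $T_{\frac12}$: for all $i\neq j$ in $\{1,2\}$ every set that is $g_{\mu_i}$-closed with respect to $\mu_j$ is $\mu_i$-closed. Pairwise $T_{\frac14}$ (respectively pairwise $T_{\frac38}$, pairwise $T_{\frac58}$): for every finite (respectively countable, arbitrary) subset $P$ of $X$ and every $y\in X-P$ there exists a set $A_y$ containing $P$ and disjoint from $\{y\}$ such that $A_y$ is $\mu_i$-open for some $i\in\{1,2\}$ or $\mu_j$-closed for some $j\in\{1,2\}$. For $A\subset X$, $A_{\mu}^{\wedge}=\bigcap\{U\in\mu: A\subset U\}$ (equal to $X$ if no $\mu$-open set contains $A$); $A$ is a $\wedge_{\mu}$-set if $A=A_{\mu}^{\wedge}$. For $i\neq j$, $A$ is $\lambda_{\mu_i}$-closed with respect to $\mu_j$ if $A=F_i\cap L_j$ with $F_i$ a $\mu_i$-closed set and $L_j$ a $\wedge_{\mu_j}$-set. $A$ is pairwise $\lambda$-closed if $A=(F_1\cap F_2)\cap(L_1\cap L_2)$ where $F_1,F_2$ are respectively $\mu_1$-closed and $\mu_2$-closed and $L_1,L_2$ are respectively a $\wedge_{\mu_1}$-set and a $\wedge_{\mu_2}$-set. The space is pairwise $\lambda$-symmetric if every pairwise $\lambda$-closed set is both $\lambda_{\mu_1}$-closed with respect to $\mu_2$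 and $\lambda_{\mu_2}$-closed with respect to $\mu_1$. *)

(* Defs.v *)
From mathcomp Require Import all_boot.
From mathcomp Require Import classical_sets cardinality.

Set Implicit Arguments.
Unset Strict Implicit.
Unset Printing Implicit Defensive.

Local Open Scope classical_set_scope.

(* [setT] is not required to be open. *)
Record gen_topology (T : Type) := GenTopology {
  gopen : set (set T);
  gopen0 : gopen set0;
  gopen_bigcup : forall D : set (set T),
    D `<=` gopen -> gopen (\bigcup_(U in D) U) }.

Record gbt_space := GBTSpace {
  gbt_sort :> Type;
  gbt_nonempty : [set: gbt_sort] !=set0;
  mu1 : gen_topology gbt_sort;
  mu2 : gen_topology gbt_sort }.

Section OneOrTwoTopologies.
Context {T : Type}.
Implicit Types (mu nu : gen_topology T) (A : set T).

Definition gclosed mu A := gopen mu (~` A).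

Definition gclosure mu A : set T :=
  \bigcap_(F in [set F | gclosed mu F /\ A `<=` F]) F.

(* Equal to [setT] when no open set contains [A]. *)
Definition wedge mu A : set T :=
  \bigcap_(U in [set U | gopen mu U /\ A `<=` U]) U.

Definition wedge_set mu A := A = wedge mu A.

Definition R0_wrt mu nu :=
  forall (G : set T) (x : T), gopen mu G -> G x -> gclosure nu [set x] `<=` G.

(* [A] is g_mu-closed with respect to nu. *)
Definition g_closed_wrt mu nu A :=
  forall U : set T, gopen nu U -> A `<=` U -> gclosure mu A `<=` U.

(* [A] is lambda_mu-closed with respect to nu. *)
Definition lambda_closed_wrt mu nu A :=
  exists F L : set T, [/\ gclosed mu F, wedge_set nu L & A = F `&` L].

End OneOrTwoTopologies.

Section Pairwise.
Variable X : gbt_space.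
Local Notation mu1 := (mu1 X).
Local Notation mu2 := (mu2 X).

Definition pairwise_R0 := R0_wrt mu1 mu2 /\ R0_wrt mu2 mu1.

(* In T0 and T1 the disjunction over the two namings of the points is
   essential: mu1 and mu2 play asymmetric roles. *)
Definition T0_separated (x y : X) :=
  (exists U : set X, [/\ gopen mu1 U, U x & ~ U y]) \/
  (exists V : set X, [/\ gopen mu2 V, V y & ~ V x]).

Definition pairwise_T0 :=
  forall x y : X, x <> y -> T0_separated x y \/ T0_separated y x.

Definition T1_separated (x y : X) :=
  exists U V : set X,
    [/\ gopen mu1 U, gopen mu2 V, U x /\ ~ U y & V y /\ ~ V x].

Definition pairwise_T1 :=
  forall x y : X, x <> y -> T1_separated x y \/ T1_separated y x.

Definition pairwise_T12 :=
  (forall A : set X, g_closed_wrt mu1 mu2 A -> gclosed mu1 A) /\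
  (forall A : set X, g_closed_wrt mu2 mu1 A -> gclosed mu2 A).

Definition separated_by_open_or_closed (P : set X) :=
  forall y : X, (~` P) y ->
    exists A : set X,
      [/\ P `<=` A, A `&` [set y] = set0 &
          (gopen mu1 A \/ gopen mu2 A) \/ (gclosed mu1 A \/ gclosed mu2 A)].

Definition pairwise_T14 :=
  forall P : set X, finite_set P -> separated_by_open_or_closed P.

Definition pairwise_T38 :=
  forall P : set X, countable P -> separated_by_open_or_closed P.

Definition pairwise_T58 :=
  forall P : set X, separated_by_open_or_closed P.

Definition pairwise_lambda_closed (A : set X) :=
  exists F1 F2 L1 L2 : set X,
    [/\ gclosed mu1 F1 /\ gclosed mu2 F2, wedge_set mu1 L1 /\ wedge_set mu2 L2
      & A = (F1 `&` F2) `&` (L1 `&` L2)].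

Definition pairwise_lambda_symmetric :=
  forall A : set X, pairwise_lambda_closed A ->
    lambda_closed_wrt mu1 mu2 A /\ lambda_closed_wrt mu2 mu1 A.

End Pairwise.

(* Main.v *)
Require Import Defs.
From mathcomp Require Import all_boot.
From mathcomp Require Import boolp classical_sets cardinality.

(** If [x] lies in a [mu_i]-open set missing [y], then by R0 so does the
    [mu_j]-closure of [x], whose complement separates [y] from [x]: thus T0
    yields T1. Under T1 every singleton is the intersection of its two closures
    and its two wedges, so lambda-symmetry writes it as a [mu_i]-closed set
    intersected with a [mu_j]-wedge; by R0 both factors contain the [mu_i]-closure
    of the point, so points are closed in both topologies, whence T1/2. For T5/8
    from T1/2: the complement of a point is either [mu2]-open or vacuously
    g-closed, hence [mu1]-closed. *)

Set Implicit Arguments.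
Unset Strict Implicit.
Unset Printing Implicit Defensive.

Local Open Scope classical_set_scope.

Section OneOrTwoTopologies.
Context {T : Type}.
Implicit Types (mu nu : gen_topology T) (A : set T).

Lemma gclosed_gclosure mu A : gclosed mu (gclosure mu A).
Proof.
rewrite /gclosed /gclosure setC_bigcap.
(* Reindexing by complements turns this into a union of open sets, the form [gopen_bigcup]
   accepts. *)
have -> : \bigcup_(F in [set F | gclosed mu F /\ A `<=` F]) ~` F =
          \bigcup_(U in [set U | gopen mu U /\ A `<=` ~` U]) U.
  rewrite eqEsubset; split=> x [B [cB AB] Bx].
    by exists (~` B) => //; split=> //; rewrite setCK.
  by exists (~` B); rewrite ?setCK //; split=> //; rewrite /gclosed setCK.
by apply: gopen_bigcup => U [].
Qed.

Lemma sub_gclosure mu A : A `<=` gclosure mu A.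
Proof. by move=> x Ax F [_]; apply. Qed.

Lemma gclosure_min mu A F : gclosed mu F -> A `<=` F -> gclosure mu A `<=` F.
Proof. by move=> cF AF x; apply. Qed.

Lemma gclosed_sub_gclosure mu A : gclosure mu A `<=` A -> gclosed mu A.
Proof.
move=> sA; suff <- : gclosure mu A = A by exact: gclosed_gclosure.
by rewrite eqEsubset; split=> //; exact: sub_gclosure.
Qed.

Lemma sub_wedge mu A : A `<=` wedge mu A.
Proof. by move=> x Ax U [_]; apply. Qed.

Lemma wedge_set_wedge mu A : wedge_set mu (wedge mu A).
Proof.
rewrite /wedge_set eqEsubset; split; first exact: sub_wedge.
by move=> x wx U [oU AU]; apply: wx; split=> // z; apply.
Qed.

Lemma R0_gclosed_set1 mu nu x : R0_wrt nu mu ->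
  lambda_closed_wrt mu nu [set x] -> gclosed mu [set x].
Proof.
move=> R0 [F [L [cF wL xE]]].
have [Fx Lx] : (F `&` L) x by rewrite -xE.
apply: gclosed_sub_gclosure => z cz; rewrite xE; split.
  by apply: (gclosure_min cF _ cz) => _ ->.
rewrite wL => U [oU LU]; exact: (R0 U x oU (LU x Lx)).
Qed.

Lemma gclosed_set1_g_closed mu nu A : (forall x, gclosed nu [set x]) ->
  g_closed_wrt mu nu A -> gclosed mu A.
Proof.
move=> c1 gA; apply: gclosed_sub_gclosure => y cy; apply: contrapT => nAy.
have AyC : A `<=` ~` [set y] by move=> z Az zy; apply: nAy; rewrite -zy.
exact: (gA _ (c1 y) AyC _ cy).
Qed.

Lemma g_closed_setC1 mu nu y : ~ gopen nu (~` [set y]) ->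
  g_closed_wrt mu nu (~` [set y]).
Proof.
move=> nO U oU sU z _; have [->|] := EM (z = y); last exact: sU.
apply: contrapT => nUy; apply: nO; suff -> : ~` [set y] = U by [].
by rewrite eqEsubset; split=> // t Ut /= ty; apply: nUy; rewrite -ty.
Qed.

Lemma R0_separate mu nu U x y : R0_wrt mu nu -> gopen mu U -> U x -> ~ U y ->
  exists V, [/\ gopen nu V, V y & ~ V x].
Proof.
move=> R0 oU Ux nUy; exists (~` gclosure nu [set x]); split.
- exact: gclosed_gclosure.
- by move=> cy; apply: nUy; exact: (R0 U x oU Ux _ cy).
- by apply; exact: sub_gclosure.
Qed.

End OneOrTwoTopologies.

Section Pairwise.
Variable X : gbt_space.

Lemma R0_T0_separated_T1 (x y : X) : pairwise_R0 X ->
  T0_separated x y -> T1_separated x y.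
Proof.
move=> [R12 R21] [[U [oU Ux nUy]]|[V [oV Vy nVx]]].
  by have [V [oV Vy nVx]] := R0_separate R12 oU Ux nUy; exists U, V.
by have [U [oU Ux nUy]] := R0_separate R21 oV Vy nVx; exists U, V.
Qed.

Lemma T1_pairwise_lambda_closed_set1 (x : X) :
  pairwise_T1 X -> pairwise_lambda_closed [set x].
Proof.
move=> T1; exists (gclosure (mu1 X) [set x]), (gclosure (mu2 X) [set x]),
  (wedge (mu1 X) [set x]), (wedge (mu2 X) [set x]).
split; first by split; exact: gclosed_gclosure.
  by split; exact: wedge_set_wedge.
rewrite eqEsubset; split=> [_ ->|y [_ [w1 w2]]].
  by split; split; (exact: sub_gclosure || exact: sub_wedge).
apply: contrapT => /= yx.
(* The naming chosen by T1 decides whether the open set around [x] missing [y] lies in [mu2] or in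
   [mu1], hence which wedge excludes [y]. *)
have [[U [V [oU oV [Uy nUx] [Vx nVy]]]]|[U [V [oU oV [Ux nUy] _]]]] := T1 y x yx.
  by apply: nVy; apply: w2; split=> // _ ->.
by apply: nUy; apply: w1; split=> // _ ->.
Qed.

Lemma R0_lambda_symmetric_T1_T12 : pairwise_R0 X ->
  pairwise_lambda_symmetric X -> pairwise_T1 X -> pairwise_T12 X.
Proof.
move=> [R12 R21] sym T1.
have lc x := sym _ (T1_pairwise_lambda_closed_set1 x T1).
(* The indices cross: the [mu1] half of T1/2 uses [mu2]-closed points, and conversely. *)
split=> A; apply: gclosed_set1_g_closed => x.
  exact: R0_gclosed_set1 R12 (lc x).2.
exact: R0_gclosed_set1 R21 (lc x).1.
Qed.

(** The largest set avoiding [y] serves every [P] at once. *)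
Lemma T12_T58 : pairwise_T12 X -> pairwise_T58 X.
Proof.
move=> [T12 _] P y nPy; exists (~` [set y]); split.
- by move=> z Pz zy; apply: nPy; rewrite -zy.
- by rewrite setICl.
- have [|nO] := EM (gopen (mu2 X) (~` [set y])); first by left; right.
  by right; left; apply: T12; exact: g_closed_setC1.
Qed.

Lemma T14_T0 : pairwise_T14 X -> pairwise_T0 X.
Proof.
move=> T14 x y xy.
have [|A [xA Ay oc]] := T14 [set x] (finite_set1 x) y.
  by move=> /= yx; apply: xy.
have Ax : A x by exact: xA.
have nAy : ~ A y by move=> Ay'; have : (A `&` [set y]) y by []; rewrite Ay.
have nCAx : ~ (~` A) x by apply.
case: oc => [[oA|oA]|[cA|cA]].
- by left; left; exists A.
- by right; right; exists A.
- by right; left; exists (~` A).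
- by left; right; exists (~` A).
Qed.

End Pairwise.

Local Close Scope classical_set_scope.

Theorem corollary5p1 (X : gbt_space)
    (hR0 : pairwise_R0 X) (hsym : pairwise_lambda_symmetric X) :
  [<-> pairwise_T0 X;
       pairwise_T1 X;
       pairwise_T12 X;
       pairwise_T58 X;
       pairwise_T38 X;
       pairwise_T14 X].
Proof.
tfae.
- move=> T0 x y /T0[] s; [left|right]; exact: R0_T0_separated_T1.
- exact: R0_lambda_symmetric_T1_T12.
- exact: T12_T58.
- by move=> T58 P _; exact: T58.
- by move=> T38 P /finite_set_countable; exact: T38.
- exact: T14_T0.
Qed.
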